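(* Let $k\ge 1$ and let $C_{2k+1}$ be an edge-ordered cycle on $2k+1$ vertices (with any edge-ordering). Then \[sat_e(n,C_{2k+1})=\Theta(n)\quad\text{and}\quad ssat_e(n,C_{2k+1})=\Theta(n).\]
   Context: An edge-ordered graph is a finite simple graph together with a linear order on its edge set (usually given by an injective labeling $l:E\to\mathbb{N}$ or $l:E\to\mathbb{R}$). An edge-ordered graph $H$ contains $G$ (has a copy of $G$) if $G$ is isomorphic, by an isomorphism respecting the edge-order, to a subgraph of $H$ with the induced order; otherwise $H$ is $G$-free. $ssat_e(n,G)$ is the minimum number of edges in an edge-ordered graph $H$ on $n$ vertices such that adding to $H$ any missing edge, inserted at an arbitrary position of the linear order of the edges, creates a new copy of $G$ (one using the added edge); that is, for every missing edge and every position a new copy is created. $sat_e(n,G)$ is defined in the same way with the additional requirement that $H$ is $G$-free. Asymptotic notation is for $n\to\infty$ with the edge-ordered graph $G$ fixed. *)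

(* Defs.v *)
From mathcomp Require Import all_boot all_algebra.
From mathcomp Require Import all_classical all_reals all_analysis.

Set Implicit Arguments.
Unset Strict Implicit.
Unset Printing Implicit Defensive.

Local Open Scope nat_scope.
Local Open Scope classical_set_scope.

(* A finite simple graph on [T] together with a linear order on its edge set:
   the duplicate-free list of its edges (two-element sets of vertices), in
   increasing order. *)
Record eograph (T : finType) := EOGraph {
  edges :> seq {set T};
  edges_wf : uniq edges && all [pred e : {set T} | #|e| == 2] edges
}.

(* [subseq] says at once that every edge of [G] is sent to an edge of the target
   and that the edge-order is respected. The target is a bare list so that it
   can be a graph with an edge just inserted. *)
Definition is_copy (U T : finType) (G : eograph U) (s : seq {set T})
    (f : U -> T) : Prop :=
  injective f /\ subseq [seq f @: e | e : {set U} <- edges G]%SET s.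

Definition eofree (U T : finType) (G : eograph U) (H : eograph T) : Prop :=
  ~ exists f : U -> T, is_copy G H f.

Definition missing (T : finType) (H : eograph T) (e : {set T}) : Prop :=
  #|e| = 2 /\ e \notin edges H.

Definition insert_at (X : Type) (i : nat) (x : X) (s : seq X) : seq X :=
  take i s ++ x :: drop i s.

Definition semisaturated (U T : finType) (G : eograph U) (H : eograph T) :
    Prop :=
  forall (e : {set T}) (i : nat), missing H e -> i <= size H ->
    exists f : U -> T, is_copy G (insert_at i e H) f /\
      e \in [seq f @: e' | e' : {set U} <- edges G]%SET.

Definition saturated (U T : finType) (G : eograph U) (H : eograph T) : Prop :=
  eofree G H /\ semisaturated G H.

Definition is_min_edges (T : finType) (S : set (eograph T)) (m : nat) : Prop :=
  (exists2 H, S H & size H = m) /\ (forall H, S H -> m <= size H).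

(* Junk value 0 when [S] is empty; see [sat_e_min] and [ssat_e_min]. *)
Definition min_edges (T : finType) (S : set (eograph T)) : nat :=
  xget 0 [set m | is_min_edges S m].

Definition ssat_e (U : finType) (n : nat) (G : eograph U) : nat :=
  min_edges [set H : eograph 'I_n | semisaturated G H].

Definition sat_e (U : finType) (n : nat) (G : eograph U) : nat :=
  min_edges [set H : eograph 'I_n | saturated G H].

(* The underlying graph of [C] is a Hamiltonian cycle on [T], with the edges in
   any order; meant for [3 <= #|T|], where the edges [c_i c_(i+1)] are distinct
   two-element sets. *)
Definition is_eocycle (T : finType) (C : eograph T) : Prop :=
  exists c : seq T, [/\ uniq c, c =i T &
    perm_eq (edges C) [seq [set x; next c x]%SET | x <- c]].

Lemma min_edgesP (T : finType) (S : set (eograph T)) :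
  (exists H, S H) -> is_min_edges S (min_edges S).
Proof.
move=> [H0 SH0]; apply: xgetPex.
pose P := [pred m | `[< exists2 H, S H & size (edges H) = m >]].
have exP : exists m, P m by exists (size H0); apply/asboolP; exists H0.
case: (ex_minnP exP) => m /asboolP[H SH sH] mmin.
exists m; split; first by exists H.
by move=> H' SH'; apply: mmin; apply/asboolP; exists H'.
Qed.

Lemma size_eograph (T : finType) (H : eograph T) : size H <= 'C(#|T|, 2).
Proof.
have /andP[uH /allP aH] := edges_wf H.
rewrite -card_draws -(card_uniqP uH); apply: subset_leq_card.
by apply/fintype.subsetP => e /aH /=; rewrite inE.
Qed.

Lemma insert_at_wf (T : finType) (H : eograph T) (e : {set T}) i :
  missing H e ->
  uniq (insert_at i e H) &&
  all [pred e : {set T} | #|e| == 2] (insert_at i e H).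
Proof.
have /andP[uH aH] := edges_wf H; move=> [e2 eH].
have pe : perm_eq (insert_at i e H) (e :: H).
  by rewrite /insert_at perm_catC /= perm_cons perm_catC cat_take_drop.
by rewrite (perm_uniq pe) (perm_all _ pe) /= eH uH aH e2 eqxx.
Qed.

Lemma saturated_exists (U T : finType) (G : eograph U) :
  0 < size G -> exists H : eograph T, saturated G H.
Proof.
move=> G0.
suff main k (H : eograph T) : 'C(#|T|, 2) - size H <= k -> eofree G H ->
    exists H : eograph T, saturated G H.
  have /main : 'C(#|T|, 2) - size (EOGraph (isT : uniq ([::] : seq {set T}) &&
    all [pred e : {set T} | #|e| == 2] [::])) <= 'C(#|T|, 2) by rewrite leq_subr.
  apply=> -[f [_ /size_subseq]].
  by rewrite size_map leqNgt G0.
elim: k H => [|k IH] H sk Hfree.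
all: have [|nsat] := pselect (semisaturated G H); first by exists H.
all: have [e [i [me nocopy]]] : exists e i, missing H e /\
    ~ exists f : U -> T, is_copy G (insert_at i e H) f /\
      e \in [seq f @: e' | e' : {set U} <- edges G]%SET.
1,3: apply: contrapT => nex; apply: nsat => e i me _; apply: contrapT => nc.
1,2: by apply: nex; exists e, i.
all: have sz : size (EOGraph (insert_at_wf i me)) = (size H).+1.
1,3: by rewrite /= /insert_at size_cat /= addnS -size_cat cat_take_drop.
  have := size_eograph (EOGraph (insert_at_wf i me)); rewrite sz ltnNge.
  by rewrite -subn_eq0 -leqn0 sk.
apply: (IH (EOGraph (insert_at_wf i me))).
  by rewrite sz subnS -subn1 leq_subLR add1n.
move=> -[f [finj fsub]]; have [ein|eni] := boolP
    (e \in [seq f @: e' | e' : {set U} <- edges G]%SET).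
  by apply: nocopy; exists f.
apply: Hfree; exists f; split=> //.
have : all (predC1 e) [seq f @: e' | e' : {set U} <- edges G]%SET.
  by rewrite all_predC has_pred1.
move=> /all_filterP <-; have [_ eH] := me.
have <- : seq.filter (predC1 e) (insert_at i e H) = H :> seq _.
  rewrite filter_cat /= eqxx -filter_cat cat_take_drop.
  by apply/all_filterP; rewrite all_predC has_pred1.
have := subseq_trans (filter_subseq (predC1 e) _) fsub.
by rewrite subseq_filter filter_all => ->.
Qed.

Lemma sat_e_min (U : finType) n (G : eograph U) : 0 < size G ->
  is_min_edges [set H : eograph 'I_n | saturated G H] (sat_e n G).
Proof. by move=> G0; apply: min_edgesP; exact: saturated_exists. Qed.

Lemma ssat_e_min (U : finType) n (G : eograph U) : 0 < size G ->
  is_min_edges [set H : eograph 'I_n | semisaturated G H] (ssat_e n G).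
Proof.
move=> /(@saturated_exists _ 'I_n)[H [_ satH]].
by apply: min_edgesP; exists H.
Qed.

(* Main.v *)
(** Upper bound: remove the largest (resp. smallest) edge ab of the cycle and
    blow up the remaining path by letting both ends a and b range over a large
    vertex set W, the inner vertices being fixed and the images of one path edge
    forming a block of consecutive labels. Since the path has even length, both
    gadgets are bipartite with W inside one class. Put all labels of the first
    gadget below those of the second, on disjoint sets of inner vertices: the
    union is bipartite, hence contains no odd cycle, and a new edge inside W has
    all of the first gadget below it or all of the second above it, so that it
    can play the largest or the smallest edge of a copy. A maximal C-free
    extension is saturated and all its edges meet the O(1) inner vertices.

    Lower bound: a new edge joining two isolated vertices lies on no cycle, so
    a semisaturated graph has at most one isolated vertex. *)

Require Import Defs.
From mathcomp Require Import all_boot all_algebra.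
From mathcomp Require Import all_classical all_reals all_analysis.
From mathcomp Require Import zify.
Import GRing.Theory Num.Theory numFieldNormedType.Exports.

Set Implicit Arguments.
Unset Strict Implicit.
Unset Printing Implicit Defensive.

Section EdgeOrderedCycles.
Local Open Scope nat_scope.
Implicit Types (U V T : finType).

(** * Edge lists, insertion and saturated extensions *)

Lemma set2_eq T (x y z w : T) :
  [set x; y]%SET = [set z; w]%SET -> (x = z /\ y = w) \/ (x = w /\ y = z).
Proof.
move=> /setP E; have := E x; have := E y; have := E z; have := E w.
rewrite !inE !eqxx /= ?orbT.
do ![case: eqVneq => [->|?] //=]; move=> *; auto.
Qed.

Lemma perm_insert_at (X : eqType) i (x : X) s : perm_eq (insert_at i x s) (x :: s).
Proof. by rewrite /insert_at perm_catC /= perm_cons perm_catC cat_take_drop. Qed.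

Lemma subseq_insert_at (X : eqType) i (x : X) s : subseq s (insert_at i x s).
Proof.
rewrite -{1}(cat_take_drop i s); apply: cat_subseq => //; exact: subseq_cons.
Qed.

(** In a mask selecting [s] from [t], the bit at [x] must be false because [x] is not in [s];
    switching it on inserts [x] into [s]. This turns a copy in a base graph plus one edge into a
    copy in an extension containing that edge. *)
Lemma insert_at_subseq (X : eqType) (x : X) s t :
  x \in t -> x \notin s -> subseq s t ->
  exists2 i, i <= size s & subseq (insert_at i x s) t.
Proof.
case/splitPr: t / => p q xs /subseqP[m sm def_s].
have sm1 : size (take (size p) m) = size p.
  by rewrite size_takel // sm size_cat leq_addr.
move: def_s; rewrite -(cat_take_drop (size p) m) mask_cat //.
case: (drop _ _) => [|b m2] def_s.
  exists (size s) => //; rewrite /insert_at take_size drop_size def_s mask0s.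
  by rewrite cats0 cat_subseq ?mask_subseq //= eqxx sub0seq.
move: def_s xs => /= ->; case: b => /=.
  by rewrite mem_cat inE eqxx orbT.
set m1 := mask _ _ => _; exists (size m1); first by rewrite size_cat leq_addr.
rewrite /insert_at take_size_cat // drop_size_cat // cat_subseq ?mask_subseq //.
by rewrite /= eqxx mask_subseq.
Qed.

(** A [G]-free extension of [H] with the most edges works: inserting one more edge anywhere creates
    a copy, and that copy uses the new edge. *)
Lemma saturated_extension U T (G : eograph U) (H : eograph T) :
  eofree G H -> exists2 H' : eograph T, saturated G H' & subseq H H'.
Proof.
move=> freeH.
pose P := [pred m | `[< exists H' : eograph T,
  [/\ eofree G H', subseq H H' & size H' = m] >]].
have exP : exists m, P m by exists (size H); apply/asboolP; exists H.
have ubP m : P m -> m <= 'C(#|T|, 2).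
  by move=> /asboolP[H' [_ _ <-]]; exact: size_eograph.
case: (ex_maxnP exP ubP) => m /asboolP[H' [freeH' HH' sH']] maxm.
exists H' => //; split=> // e i me _; apply: contrapT => nocopy.
suff freeI : eofree G (EOGraph (insert_at_wf i me)).
  have /maxm : P m.+1; last by rewrite ltnn.
  apply/asboolP; exists (EOGraph (insert_at_wf i me)); split=> //=.
    exact: subseq_trans HH' (subseq_insert_at _ _ _).
  by rewrite (perm_size (perm_insert_at _ _ _)) /= sH'.
move=> [f [injf subf]]; have [ein|eni] := boolP
    (e \in [seq f @: e' | e' : {set U} <- edges G]).
  by apply: nocopy; exists f.
(* A copy avoiding [e] survives when [e] is filtered out again, so it already lies in [H']. *)
apply: freeH'; exists f; split=> //; move: subf => /=.
have : all (predC1 e) [seq f @: e' | e' : {set U} <- edges G].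
  by rewrite all_predC has_pred1.
have H'e : seq.filter (predC1 e) (insert_at i e H') = H' :> seq _.
  rewrite filter_cat /= eqxx -filter_cat cat_take_drop.
  by apply/all_filterP; rewrite all_predC has_pred1; case: me.
by move=> He Hs; rewrite -H'e subseq_filter He.
Qed.

(** * Odd cycles: two-colourings and cutting at an edge *)

(** The colour of the image flips at each step along the cycle, so the bijection [next c] exchanges
    the two colour classes and [#|V|] would be even. *)
Lemma eocycle_odd_not_bipartite V T (C : eograph V) (chi : pred T)
    (s : seq {set T}) (f : V -> T) :
  is_eocycle C -> odd #|V| -> is_copy C s f ->
  (forall e, e \in s -> exists x y, [/\ e = [set x; y]%SET, chi x & ~~ chi y]) ->
  False.
Proof.
move=> [c [uc cV pC]] oddV [injf /mem_subseq subf] bip.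
have alt x : chi (f (next c x)) = ~~ chi (f x).
  have : f @: [set x; next c x]%SET \in s.
    apply/subf/map_f; rewrite (perm_mem pC).
    by apply/mapP; exists x; rewrite ?cV.
  move=> /bip[y [z []]]; rewrite imsetU1 imset_set1 => /set2_eq.
  by case=> -[-> ->] => [-> /negbTE ->|-> /negbTE ->].
pose A := [set x | chi (f x)]%SET.
have : #|A| = #|~: A|.
  rewrite -(card_preimset A (can_inj (prev_next uc))).
  by apply: eq_card => x; rewrite !inE alt.
have := cardsC A => + E; rewrite -E addnn => Ev.
by move: oddV; rewrite -Ev odd_double.
Qed.

(* [ix] numbers the vertices along the path left by removing the edge [e = ab]. *)
Lemma eocycle_cut V (C : eograph V) (e : {set V}) : is_eocycle C -> e \in edges C ->
  exists (a b : V) (ix : V -> nat),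
  [/\ e = [set a; b]%SET, ix a = 0 & ix b = #|V|.-1] /\
  [/\ injective ix, forall j, j < #|V| -> exists x, ix x = j,
      forall x, ix x < #|V|,
      forall x y, ix y = (ix x).+1 -> [set x; y]%SET \in edges C &
      forall e', e' \in edges C -> e' != e ->
        exists x y, e' = [set x; y]%SET /\ ix y = (ix x).+1].
Proof.
move=> [c [uc cV pC]]; rewrite (perm_mem pC) => /mapP[b bc ->].
have ac : next c b \in c by rewrite mem_next.
move: (erefl (next c b)) ac; move: {1 3}(next c b) => a ba ac.
(* The cycle is rotated to start at [a], the successor of [b]; then [b] comes last, since otherwise
   [a] would occur again in [p]. *)
have [i p defc] := rot_to ac.
have uc' : uniq (a :: p) by rewrite -defc rot_uniq.
have cV' : a :: p =i V by move=> x; rewrite -defc mem_rot cV.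
have nx x : next c x = nth a p (index x (a :: p)).
  have -> : next c x = next (a :: p) x by rewrite -defc next_rot.
  rewrite next_nth; case: ifP => //; by rewrite cV'.
have sz : #|V| = (size p).+1 by rewrite -(eq_card cV'); apply/card_uniqP: uc'.
have ixlt x : index x (a :: p) < (size p).+1 by rewrite index_mem cV'.
have memC e' : (e' \in edges C) = (e' \in [seq [set x; next c x]%SET | x <- a :: p]).
  by rewrite (perm_mem pC) -defc map_rot mem_rot.
have inj : injective (index^~ (a :: p)).
  by move=> x y; apply: (index_inj a); rewrite cV'.
have ixb : index b (a :: p) = size p.
  apply/eqP; rewrite eqn_leq -ltnS ixlt leqNgt /=; apply/negP => lt.
  move: uc' => /= /andP[/negP[]]; rewrite {1}ba nx.
  exact: mem_nth.
have ixn x : x != b -> index (next c x) (a :: p) = (index x (a :: p)).+1.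
  move=> xb; have lt : index x (a :: p) < size p.
    rewrite ltn_neqAle -ltnS ixlt andbT; apply: contra xb => /eqP E.
    by apply/eqP/inj; rewrite E ixb.
  by rewrite nx -[nth a p _]/(nth a (a :: p) (index x (a :: p)).+1) index_uniq.
exists a, b, (index^~ (a :: p)); split; first split => //.
- by rewrite -ba finset.setUC.
- by rewrite /= eqxx.
- by rewrite sz ixb.
split=> //.
- move=> j; rewrite sz => lt; exists (nth a (a :: p) j).
  by rewrite index_uniq.
- by move=> x; rewrite sz ixlt.
- move=> x y E; rewrite memC; apply/mapP; exists x; first by rewrite cV'.
  congr [set _; _]%SET; apply: inj; rewrite ixn //.
  by apply/eqP => xb; move: (ixlt y); rewrite E xb ixb ltnn.
- move=> e'; rewrite memC => /mapP[x _ ->] ne.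
  exists x, (next c x); split=> //; apply: ixn.
  by apply: contra ne => /eqP ->.
Qed.

(** * Blowing up a path with an even number of edges *)

Lemma subseq_pair (X : eqType) (x y : X) s : x \in s -> y \in s -> x != y ->
  subseq [:: x; y] s \/ subseq [:: y; x] s.
Proof.
case/splitPr: s / => p q; rewrite mem_cat inE => /or3P[yp|/eqP->|yq] ne.
- right; rewrite (@cat_subseq _ [:: y] [:: x] p (x :: q)) ?sub1seq //.
  by rewrite mem_head.
- by rewrite eqxx in ne.
- left; rewrite (@cat_subseq _ [::] [:: x; y] p (x :: q)) ?sub0seq //=.
  by rewrite eqxx sub1seq.
Qed.

Lemma uniq_flatten_map (X Y : eqType) (B : X -> seq Y) (s : seq X) :
  uniq s -> (forall x, uniq (B x)) ->
  {in s &, forall x x', has [in B x] (B x') -> x = x'} ->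
  uniq (flatten (map B s)).
Proof.
elim: s => //= x s IH /andP[xs us] uB inj; rewrite cat_uniq uB IH //; last first.
  by move=> y y' ys y's; apply: inj; rewrite inE ?ys ?y's orbT.
rewrite andbT; apply/hasPn => z /flatten_mapP[y ys zy]; apply: contra xs => zx.
suff -> : x = y by [].
by apply: inj; rewrite ?mem_head ?inE ?ys ?orbT //; apply/hasP; exists z.
Qed.

Section PathBlowup.
Variables (V T : finType) (a b : V) (io : V -> T).

Definition reroute (u w : T) (x : V) : T :=
  if x == a then u else if x == b then w else io x.

Hypotheses (ab : a != b) (inj_io : injective io).
Variable W : {set T}.
Hypothesis ioW : forall x, io x \notin W.

Lemma reroute_inj u w : u \in W -> w \in W -> u != w -> injective (reroute u w).
Proof.
move=> uW wW uw x y; rewrite /reroute.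
have io_ne z t : t \in W -> io z <> t by move=> tW E; move: (ioW z); rewrite E tW.
case: (eqVneq x a) => [->|xa]; case: (eqVneq y a) => [->|ya] //.
- case: eqVneq => [->|yb] E; first by rewrite E eqxx in uw.
  by case: (io_ne y u).
- case: eqVneq => [->|xb] E; first by rewrite E eqxx in uw.
  by case: (io_ne x u).
case: (eqVneq x b) => [->|xb]; case: (eqVneq y b) => [->|yb] // E.
- by case: (io_ne y w).
- by case: (io_ne x w).
- exact: inj_io.
Qed.

Lemma reroute_pair u w : reroute u w @: [set a; b]%SET = [set u; w]%SET.
Proof.
by rewrite imsetU1 imset_set1 /reroute !eqxx eq_sym (negbTE ab).
Qed.

Variable ix : V -> nat.
Hypotheses (inj_ix : injective ix) (ixa : ix a = 0) (ixb : ix b = #|V|.-1).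
Hypotheses (ixlt : forall x, ix x < #|V|) (oddV : odd #|V|).
Variable P : seq {set V}.
Hypotheses (uP : uniq P) (sP : size P = #|V|.-1).
Hypothesis pathP : forall e, e \in P ->
  exists x y, e = [set x; y]%SET /\ ix y = (ix x).+1.

(** Both ends of the path have even position. Hence vertices at odd positions are never rerouted,
    and [W] joins the even class. *)
Let even_ixb : ~~ odd (ix b).
Proof. by rewrite ixb; case: #|V| oddV. Qed.

Let bip e : e \in P ->
  exists x y, [/\ e = [set x; y]%SET, ~~ odd (ix x) & odd (ix y)].
Proof.
move=> /pathP[x [y [-> E]]]; case ox: (odd (ix x)).
  by exists y, x; rewrite finset.setUC E /= ox.
by exists x, y; rewrite E /= ox.
Qed.

Let reroute_odd u w y : odd (ix y) -> reroute u w y = io y.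
Proof.
move=> oy; rewrite /reroute; case: eqP => [ya|_].
  by rewrite ya ixa in oy.
by case: eqP => // yb; rewrite yb (negbTE even_ixb) in oy.
Qed.

Let reroute_cases u w x : u \in W -> w \in W ->
  (x = a \/ x = b) /\ reroute u w x \in W \/
  [/\ x != a, x != b & reroute u w x = io x].
Proof.
rewrite /reroute => uW wW; case: (eqVneq x a) => [|_]; first by left; auto.
by case: (eqVneq x b) => [|_]; [left; auto|right].
Qed.

(** The second clause encodes bipartiteness: odd positions on one side, [W] and even positions on
    the other. The third prescribes only the image of the pair of ends, so that [a] may go to either
    of [u] and [w]. *)
Definition path_blowup (L : seq {set T}) : Prop :=
  [/\ uniq L,
    forall e, e \in L -> exists s y, [/\ e = [set s; io y]%SET, odd (ix y) &
      s \in W \/ exists2 x, ~~ odd (ix x) & s = io x] &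
    forall u w, u \in W -> w \in W -> u != w ->
    exists f : V -> T, [/\ injective f, f @: [set a; b]%SET = [set u; w]%SET &
      subseq [seq f @: e | e : {set V} <- P] L]].

(* In a triangle the two path edges range over the same star; its edges can be
   listed in any order because the roles of [a] and [b] can be exchanged. *)
Let blowup3 : #|V| = 3 -> exists L, path_blowup L.
Proof.
move=> V3; have ix2 x : ~~ odd (ix x) -> x = a \/ x = b.
  move: (ixlt x); rewrite V3; case E: (ix x) => [|[|[|]]] // _ _.
    by left; apply: inj_ix; rewrite E ixa.
  by right; apply: inj_ix; rewrite E ixb V3.
have ix1 x y : odd (ix x) -> odd (ix y) -> x = y.
  move: (ixlt x) (ixlt y); rewrite V3.
  case E: (ix x) => [|[|[|]]] //; case E': (ix y) => [|[|[|]]] // _ _ _ _.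
  by apply: inj_ix; rewrite E E'.
have [y oy defP] : exists2 y, odd (ix y) &
    P = [:: [set a; y]; [set b; y]]%SET \/ P = [:: [set b; y]; [set a; y]]%SET.
  move: uP sP bip; rewrite V3; case: P => [|e [|e' []]] //=.
  rewrite andbT inE => ne _ bp.
  have [x [y [defe ex oy]]] := bp e (mem_head _ _).
  have [x' [y' [defe' ex' oy']]] := bp e' (mem_last e [:: e']).
  rewrite (ix1 y' y) // in defe'; exists y => //.
  move: ne; rewrite defe defe'.
  case: (ix2 _ ex) (ix2 _ ex') => -> [] ->; rewrite ?eqxx //.
    by left.
  by right.
exists [seq [set w; io y]%SET | w <- enum W]; split.
- rewrite map_inj_in_uniq ?enum_uniq // => u w; rewrite !mem_enum => uW _.
  by move=> /set2_eq[[]//|[E _]]; move: (ioW y); rewrite -E uW.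
- move=> e /mapP[w]; rewrite mem_enum => wW ->; exists w, y; split=> //.
  by left.
(* When [u] precedes [w] in the star, the first path edge must go to the edge at [u]; the order of
   [P] decides which of [a] and [b] is sent there. *)
- have copy u w : u \in W -> w \in W -> u != w -> subseq [:: u; w] (enum W) ->
    exists f : V -> T, [/\ injective f, f @: [set a; b]%SET = [set u; w]%SET &
      subseq [seq f @: e | e : {set V} <- P] [seq [set w; io y]%SET | w <- enum W]].
    move=> uW wW uw sub.
    case: defP => ->; [exists (reroute u w)|exists (reroute w u)]; split=> //.
    + exact: reroute_inj.
    + by rewrite reroute_pair.
    + apply: subseq_trans (map_subseq _ sub); rewrite /= !imsetU1 !imset_set1.
      by rewrite !(reroute_odd _ _ oy) /reroute !eqxx (eq_sym b)
        (negbTE ab) /= !eqxx.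
    + by apply: reroute_inj => //; rewrite eq_sym.
    + by rewrite reroute_pair finset.setUC.
    + apply: subseq_trans (map_subseq _ sub); rewrite /= !imsetU1 !imset_set1.
      by rewrite !(reroute_odd _ _ oy) /reroute !eqxx (eq_sym b)
        (negbTE ab) /= !eqxx.
  move=> u w uW wW uw.
  have [] := @subseq_pair _ u w (enum W); rewrite ?mem_enum //; first exact: copy.
  by rewrite (finset.setUC [set u]%SET); apply: copy; rewrite // eq_sym.
Qed.

(** Here [#|V|] is at least 5, so no vertex is adjacent on the path to both [a] and [b]. The blocks
    [B e] of all rerouted images of [e] are therefore disjoint, and their concatenation in the order
    of [P] contains every rerouted path, one edge per block. *)
Let blowup_ne3 : #|V| != 3 -> exists L, path_blowup L.
Proof.
move=> V3; have nconf y : [set a; y]%SET \in P -> [set b; y]%SET \in P -> False.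
  move=> /pathP[x [z [/set2_eq Ea az]]] /pathP[x' [z' [/set2_eq Eb bz]]].
  have iy : ix y = 1.
    by case: Ea az => -[<- <-]; rewrite ixa // => ->.
  case: Eb bz => -[<- <-]; rewrite iy.
    by move=> [E]; move: ab; rewrite (inj_ix (etrans ixa E)) eqxx.
  rewrite ixb => E; move: V3; rewrite -(prednK (n := #|V|)) ?E //.
  by case: #|V| oddV.
pose B (e : {set V}) := enum [set e' : {set T} |
  [exists u in W, exists w in W, e' == reroute u w @: e]]%SET.
have BP (e : {set V}) z : reflect
    (exists u w, [/\ u \in W, w \in W & z = reroute u w @: e])
    (z \in B e).
  rewrite mem_enum inE; apply: (iffP exists_inP).
    by move=> [u uW /exists_inP[w wW /eqP->]]; exists u, w.
  by move=> [u [w [uW wW ->]]]; exists u => //; apply/exists_inP; exists w.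
have io_ne z t : t \in W -> io z <> t by move=> tW E; move: (ioW z); rewrite E tW.
exists (flatten (map B P)); split.
- apply: uniq_flatten_map => // [e|e e' eP e'P /hasP[z]]; first exact: enum_uniq.
  move=> /BP[u' [w' [uW' wW' ->]]] /BP[u [w [uW wW]]].
  have [x [y [defe ex oy]]] := bip eP; have [x' [y' [defe' ex' oy']]] := bip e'P.
  move: eP e'P; rewrite defe defe' => eP e'P.
  rewrite !imsetU1 !imset_set1 (reroute_odd _ _ oy) (reroute_odd _ _ oy').
  (* Either the odd ends agree, and then the even ends must too, or an odd end meets an even one,
     which parity and [ioW] forbid. *)
  move=> /set2_eq[[E /inj_io Ey]|[E _]].
    rewrite Ey in e'P *; congr [set _; _]%SET.
    have [[xa r]|[_ _ r]] := reroute_cases x uW wW;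
      have [[x'a r']|[_ _ r']] := reroute_cases x' uW' wW'.
    + move: (nconf y); case: xa x'a eP e'P => -> [] -> // eP e'P.
        by move=> /(_ eP e'P).
      by move=> /(_ e'P eP).
    + by case: (io_ne x' (reroute u w x)); rewrite // -E r'.
    + by case: (io_ne x (reroute u' w' x')); rewrite // E r.
    + by apply: inj_io; rewrite -r -E r'.
  have [[_ r']|[_ _ r']] := reroute_cases x' uW' wW'.
    by case: (io_ne y (reroute u' w' x')).
  by move: E ex'; rewrite r' => /inj_io ->; rewrite oy.
- move=> e /flatten_mapP[e' e'P /BP[u [w [uW wW ->]]]].
  have [x [y [-> ex oy]]] := bip e'P.
  exists (reroute u w x), y; rewrite imsetU1 imset_set1.
  rewrite (reroute_odd _ _ oy); split=> //.
  have [[_ r]|[_ _ r]] := reroute_cases x uW wW; first by left.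
  by right; exists x.
- move=> u w uW wW uw; exists (reroute u w); split.
  + exact: reroute_inj.
  + exact: reroute_pair.
  + have : forall e, e \in P -> reroute u w @: e \in B e.
      by move=> e _; apply/BP; exists u, w.
    elim: P => //= e s IH sB.
    rewrite -cat1s cat_subseq ?sub1seq ?sB ?mem_head ?IH // => e' e's.
    by apply: sB; rewrite inE e's orbT.
Qed.

Lemma path_blowup_exists : exists L, path_blowup L.
Proof. by case: (eqVneq #|V| 3); [exact: blowup3|exact: blowup_ne3]. Qed.

End PathBlowup.

(** * The bipartite base graph and the linear upper bound *)

Lemma size_eocycle V (C : eograph V) : is_eocycle C -> size C = #|V|.
Proof.
move=> [c [uc cV pC]]; rewrite (perm_size pC) size_map -(eq_card cV).
by apply/esym/card_uniqP.
Qed.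

Lemma eocycle_blowup V T (C : eograph V) (io : V -> T) (W : {set T}) (e : {set V}) :
  is_eocycle C -> odd #|V| -> 2 < #|V| -> injective io ->
  (forall x, io x \notin W) -> e \in edges C ->
  exists (ix : V -> nat) (L : seq {set T}), [/\ uniq L,
    forall e', e' \in L -> exists s y, [/\ e' = [set s; io y]%SET, odd (ix y) &
      s \in W \/ exists2 x, ~~ odd (ix x) & s = io x] &
    forall u w, u \in W -> w \in W -> u != w ->
    exists f : V -> T, [/\ injective f, f @: e = [set u; w]%SET &
      subseq [seq f @: e' | e' : {set V} <- rem e (edges C)] L]].
Proof.
move=> cC oddV V2 inj_io ioW eC; have /andP[uC /allP C2] := edges_wf C.
have [a [b [ix [[defe ixa ixb] [inj_ix _ ixlt _ pathP]]]]] := eocycle_cut cC eC.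
have ab : a != b by have := C2 _ eC; rewrite /= defe cards2; case: (a != b).
have sP : size (rem e (edges C)) = #|V|.-1 by rewrite size_rem // size_eocycle.
have PP e' : e' \in rem e (edges C) ->
    exists x y, e' = [set x; y]%SET /\ ix y = (ix x).+1.
  by rewrite mem_rem_uniq // => /andP[ne e'C]; apply: pathP.
have [L] := path_blowup_exists ab inj_io ioW inj_ix ixa ixb ixlt oddV
  (rem_uniq e uC) sP PP.
by rewrite /path_blowup -defe => ?; exists ix, L.
Qed.

(** The Boolean tells the two gadgets apart: [false] for the one cut at the largest edge [m], [true]
    for the one cut at the smallest edge [m']. The set [W] is everything outside the image of
    [io]. *)
Lemma bipartite_base V T (C : eograph V) (io : bool * V -> T) :
  is_eocycle C -> odd #|V| -> 2 < #|V| -> injective io ->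
  exists H : eograph T, eofree C H /\
    forall u w, u \notin codom io -> w \notin codom io -> u != w ->
      [set u; w]%SET \notin edges H /\
      forall i, exists f, is_copy C (insert_at i [set u; w]%SET H) f.
Proof.
move=> cC oddV V2 inj_io; have /andP[uC /allP C2] := edges_wf C.
have sC := size_eocycle cC.
have [m [P defC]] : exists m P, edges C = rcons P m.
  by case/lastP: (edges C) sC V2 => [<-//|P m]; exists m, P.
have [m' [P' defC']] : exists m P, edges C = m :: P.
  by case: (edges C) sC V2 => [<-//|n Q]; exists n, Q.
pose W := [set t | t \notin codom io]%SET.
have ioW i x : io (i, x) \notin W by rewrite inE negbK codom_f.
have inj i : injective (fun x => io (i, x)) by move=> x y /inj_io[].
have mC : m \in edges C by rewrite defC mem_rcons mem_head.
have mC' : m' \in edges C by rewrite defC' mem_head.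
have [ix0 [L0 [uL0 L0P copy0]]] :=
  eocycle_blowup cC oddV V2 (inj false) (ioW false) mC.
have [ix1 [L1 [uL1 L1P copy1]]] :=
  eocycle_blowup cC oddV V2 (inj true) (ioW true) mC'.
have remm : rem m (edges C) = P.
  move: uC; rewrite defC rcons_uniq => /andP[mP _].
  by rewrite -cats1 remE index_cat (negbTE mP) /= eqxx addn0 take_size_cat //
    drop_oversize ?cats0 // size_cat addn1.
rewrite remm in copy0.
have remm' : rem m' (edges C) = P' by rewrite defC' /= eqxx.
rewrite remm' in copy1.
pose ix (p : bool * V) := if p.1 then ix1 p.2 else ix0 p.2.
have LP e : e \in L0 ++ L1 -> exists s p, [/\ e = [set s; io p]%SET, odd (ix p) &
      s \in W \/ exists2 q, ~~ odd (ix q) & s = io q].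
  rewrite mem_cat => /orP[/L0P|/L1P] [s [y [-> oy sP]]].
    exists s, (false, y); split=> //; case: sP => [|[x ex ->]]; first by left.
    by right; exists (false, x).
  exists s, (true, y); split=> //; case: sP => [|[x ex ->]]; first by left.
  by right; exists (true, x).
have ioW' p : io p \notin W by case: p.
(* One colour class consists of the odd positions of both gadgets; all of [W] falls in the other. *)
pose chi := [pred t | [exists p, (io p == t) && odd (ix p)]].
have chi_io p : chi (io p) = odd (ix p).
  apply/existsP/idP => [[q /andP[/eqP/inj_io-> //]]|op].
  by exists p; rewrite eqxx.
have chiW s : s \in W -> ~~ chi s.
  by move=> sW; apply/existsP => -[p /andP[/eqP E _]]; move: (ioW' p); rewrite E sW.
have bipP e : e \in L0 ++ L1 ->
    exists x y, [/\ e = [set x; y]%SET, chi x & ~~ chi y].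
  move=> /LP[s [p [-> op sP]]]; exists (io p), s.
  rewrite finset.setUC chi_io; split=> //.
  by case: sP => [/chiW//|[q eq ->]]; rewrite chi_io.
have wf : uniq (L0 ++ L1) && all [pred e : {set T} | #|e| == 2] (L0 ++ L1).
  rewrite cat_uniq uL0 uL1 andbT /=; apply/andP; split.
    apply/hasPn => e /L1P[s [y [-> _ sP]]]; apply/negP => /L0P[s' [y' [+ _ sP']]].
    move=> /set2_eq[[_ /inj_io//]|[_ E]].
    case: sP' => [s'W|[x _ E']]; first by move: (ioW' (true, y)); rewrite E s'W.
    by move: E; rewrite E' => /inj_io.
  apply/allP => e /bipP[x [y [-> cx cy]]]; rewrite /= cards2.
  by case: (eqVneq x y) cx => [->|//]; rewrite (negbTE cy).
exists (EOGraph wf); split.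
  by move=> [f cf]; exact: (eocycle_odd_not_bipartite cC oddV cf bipP).
move=> u w ucod wcod uw.
have uW : u \in W by rewrite inE.
have wW : w \in W by rewrite inE.
split=> [|i].
  apply/negP => /LP[s [p [/set2_eq[[_ E]|[E _]] _ _]]].
    by move: (ioW' p); rewrite -E wW.
  by move: (ioW' p); rewrite -E uW.
(* If [i] is at least [size L0], all of [L0] precedes the new edge, which plays [m]; otherwise all
   of [L1] follows it and it plays [m']. *)
rewrite /is_copy /insert_at /=; case: (leqP (size L0) i) => iL.
  have [f [injf fm sub]] := copy0 _ _ uW wW uw; exists f; split=> //.
  rewrite defC -cats1 map_cat /= fm cat_subseq //; last by rewrite /= eqxx sub0seq.
  apply: subseq_trans sub _; rewrite take_cat ltnNge iL /=; exact: prefix_subseq.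
have [f [injf fm sub]] := copy1 _ _ uW wW uw; exists f; split=> //.
rewrite defC' /= fm drop_cat iL.
rewrite -[X in subseq X _]cat0s cat_subseq ?sub0seq //= eqxx.
exact: subseq_trans sub (suffix_subseq _ _).
Qed.

(** An edge of the extension avoiding the image of [io] would, together with the base graph, already
    yield a copy of [C]. So every edge has an end among [2 * #|V|] vertices. *)
Lemma saturated_upper V T (C : eograph V) :
  is_eocycle C -> odd #|V| -> 2 < #|V| -> 2 * #|V| <= #|T| ->
  exists2 H : eograph T, saturated C H & size H <= 2 * #|V| * #|T|.
Proof.
move=> cC oddV V2 VT.
have cVT : #|{: bool * V}| <= #|T| by rewrite card_prod card_bool.
pose io (p : bool * V) := enum_val (widen_ord cVT (enum_rank p)).
have inj_io : injective io.
  by move=> p q /enum_val_inj/(congr1 val) /= /val_inj/enum_rank_inj.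
have [H [freeH HP]] := bipartite_base cC oddV V2 inj_io.
have [H' [freeH' semiH'] HH'] := saturated_extension freeH.
exists H' => //; have /andP[uH' /allP H'2] := edges_wf H'.
pose A := [set [set io q.1; q.2]%SET | q : (bool * V) * T]%SET.
have subA : edges H' \subset A.
  apply/fintype.subsetP => e eH'; have := H'2 e eH' => /= /cards2P[u [w [uw defe]]].
  apply/imsetP; have [/codomP[p up]|ucod] := boolP (u \in codom io).
    by exists (p, w); rewrite // defe up.
  have [/codomP[p wp]|wcod] := boolP (w \in codom io).
    by exists (p, u); rewrite // defe wp finset.setUC.
  have [eH /(_ _) copy] := HP _ _ ucod wcod uw.
  rewrite defe in eH'; have [i _ sub] := insert_at_subseq eH' eH HH'.
  have [f [injf subf]] := copy i.
  by case: freeH'; exists f; split=> //; apply: subseq_trans sub.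
rewrite -(card_uniqP uH') (leq_trans (subset_leq_card subA)) //.
by rewrite (leq_trans (leq_imset_card _ _)) // !card_prod card_bool.
Qed.

(** * The linear lower bound *)

Lemma semisaturated_lower V T (C : eograph V) (H : eograph T) :
  is_eocycle C -> 2 < #|V| -> semisaturated C H -> #|T| <= (2 * size H).+1.
Proof.
move=> cC V2 ssH; have /andP[uH /allP H2] := edges_wf H.
pose D := finset.cover [set e in edges H]%SET.
have cD : #|D| <= 2 * size H.
  rewrite (leq_trans (leq_card_cover _)) //.
  rewrite (eq_bigr (fun=> 2)) => [|e]; last by rewrite inE => /H2/eqP.
  by rewrite sum_nat_const mulnC leq_mul2l cardsE /= (card_uniqP uH).
rewrite -(cardsC D) -addn1 leq_add //; apply/card_le1_eqP => w u.
rewrite !inE => wD uD; apply/eqP/negPn/negP => uw.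
have iso z e : z \notin D -> e \in edges H -> z \notin e.
  by move=> zD eH; apply: contra zD => ze; apply/bigcupP; exists e; rewrite ?inE.
have mis : missing H [set u; w]%SET.
  split; first by rewrite cards2 uw.
  by apply/negP => /(iso u _ uD); rewrite !inE eqxx.
have [f [[injf sub] /mapP[e eC defe]]] := ssH _ 0 mis (leq0n _).
have [a [b [ix [[eab ixa ixb] [inj_ix ixs _ ixC _]]]]] := eocycle_cut cC eC.
(* The vertex [y] is the other neighbour of [a] on the cycle, distinct from [b] as [#|V|] exceeds 2.
   The edge [ay] must then go to an old edge at the isolated vertex [f a]. *)
have [y iy] : exists y, ix y = 1 by apply: ixs; exact: ltn_trans V2.
have ayC : [set a; y]%SET \in edges C by apply: ixC; rewrite iy ixa.
have ne : [set a; y]%SET != e.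
  apply/eqP; rewrite eab => /set2_eq[[_ E]|[E1 E2]].
    by move: V2; rewrite E ixb in iy; move: iy; case: #|V| => [|[|[|]]].
  by move: iy; rewrite E2 ixa.
have fae : f a \in [set u; w]%SET by rewrite defe imset_f // eab !inE eqxx.
have faD : f a \notin D by move: fae; rewrite !inE => /orP[]/eqP->.
have : f @: [set a; y]%SET \in insert_at 0 [set u; w]%SET H.
  by apply: (mem_subseq sub); apply: map_f.
rewrite /insert_at take0 drop0 /= inE => /orP[|].
  by rewrite defe (inj_eq (imset_inj injf)) (negbTE ne).
by move=> /(iso _ _ faD); rewrite imset_f // !inE eqxx.
Qed.

End EdgeOrderedCycles.

(** * From explicit bounds to Theta *)

Local Open Scope ring_scope.
Local Open Scope classical_set_scope.

Lemma eqTheta_natP (R : realType) (u : nat -> nat) (A N : nat) :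
  (forall n, N <= n -> n <= (2 * u n).+1 /\ u n <= A * n)%N ->
  (fun n : nat => (u n)%:R : R^o) =Theta_\oo (fun n : nat => n%:R : R^o).
Proof.
move=> uP; rewrite eqThetaE qualifE; apply/asboolP.
(* For [n] at least 2 the lower bound forces [u n] to be positive, whence [n <= 4 * u n]. The
   successor keeps the upper constant positive even when [A] is 0. *)
exists (4^-1, A.+1%:R) => /=; first by rewrite invr_gt0 !ltr0n.
near=> n; rewrite !ger0_norm //.
have [lo up] : (n <= (2 * u n).+1 /\ u n <= A * n)%N.
  by apply: uP; near: n; exact: nbhs_infty_ge.
have n2 : (2 <= n)%N by near: n; exact: nbhs_infty_ge.
rewrite -natrM ler_nat; split; last first.
  by rewrite (leq_trans up) // leq_mul2r leqnSn orbT.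
rewrite ler_pdivrMl ?ltr0n // -natrM ler_nat.
lia.
Unshelve. all: by end_near.
Qed.

Theorem corollary57 (R : realType) (k : nat) (V : finType) (C : eograph V)
    (hk : (1 <= k)%N) (hV : #|V| = (2 * k + 1)%N) (hC : is_eocycle C) :
  (fun n : nat => (sat_e n C)%:R : R^o) =Theta_\oo (fun n : nat => n%:R : R^o)
  /\
  (fun n : nat => (ssat_e n C)%:R : R^o) =Theta_\oo (fun n : nat => n%:R : R^o).
Proof.
have oddV : odd #|V| by rewrite hV addn1 mul2n /= odd_double.
have V2 : (2 < #|V|)%N by rewrite hV; lia.
(* A cycle has edges, so saturated graphs exist and neither minimum is the default value 0. *)
have C0 : (0 < size (edges C))%N by rewrite size_eocycle //; lia.
(* The threshold makes room for the reserved vertices of both gadgets; the slope is their number. *)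
split; apply: (@eqTheta_natP _ _ (2 * #|V|) (2 * #|V|)) => n Vn.
  have [[H satH <-] minH] := sat_e_min n C0; split.
    by have := semisaturated_lower hC V2 satH.2; rewrite card_ord.
  have [|H' satH'] := @saturated_upper _ 'I_n C hC oddV V2; rewrite card_ord //.
  by apply: leq_trans; apply: minH.
have [[H satH <-] minH] := ssat_e_min n C0; split.
  by have := semisaturated_lower hC V2 satH; rewrite card_ord.
have [|H' [_ satH']] := @saturated_upper _ 'I_n C hC oddV V2; rewrite card_ord //.
by apply: leq_trans; apply: minH.
Qed.
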